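(* Let $a_1,a_2,b_1,b_2$ be real numbers with $a_1^2>a_2^2$, and for $h>0$ set $$\rho_1=\frac{a_1}{h}+b_1,\qquad \rho_2=\frac{a_2}{h}+b_2,\qquad r_1=\frac{a_1}{h},\qquad r_2=\frac{a_2}{h}.$$ Let $F_n^{(h)}(x)=h^nI_n(x/h;\rho_1,\rho_2,r_1,r_2)$, where $I_n$ are the monic complementary Bannai--Ito polynomials. Then for every $n\ge 0$ $$\lim_{h\to0}F_{2n}^{(h)}(x)=\frac{(a_2^2-a_1^2)^n(b_2+1/2)_n}{(n+b_1+b_2+1)_n}\,{}_2F_1\!\left[{-n,\;n+b_1+b_2+1\atop b_2+1/2};\frac{a_2^2-x^2}{a_2^2-a_1^2}\right],$$ $$\lim_{h\to0}F_{2n+1}^{(h)}(x)=\frac{(a_2^2-a_1^2)^n(b_2+3/2)_n}{(n+b_1+b_2+2)_n}(x-a_2)\,{}_2F_1\!\left[{-n,\;n+b_1+b_2+2\atop b_2+3/2};\frac{a_2^2-x^2}{a_2^2-a_1^2}\right].$$ Consequently, setting $$\alpha=b_2-\tfrac12,\qquad \beta=b_1+\tfrac12,\qquad \gamma=\frac{a_2}{\sqrt{a_1^2-a_2^2}},$$ one has for every $n\ge0$ $$\lim_{h\to0}\,(a_1^2-a_2^2)^{-n/2}\,F_n^{(h)}\!\left(x\sqrt{a_1^2-a_2^2}\right)=C_n(x;\alpha,\beta,\gamma),$$ where $C_n(x;\alpha,\beta,\gamma)$ are the Chihara polynomials.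
   Context: $(a)_n=a(a+1)\cdots(a+n-1)$, $(a)_0=1$, is the Pochhammer symbol and ${}_pF_q$ is the generalized hypergeometric series (terminating here). The monic complementary Bannai--Ito polynomials $I_n(x)=I_n(x;\rho_1,\rho_2,r_1,r_2)$ are, with $g=\rho_1+\rho_2-r_1-r_2$, $$I_{2n}(x)=\eta_{2n}\,{}_4F_3\!\left[{-n,\;n+g+1,\;\rho_2+x,\;\rho_2-x\atop \rho_1+\rho_2+1,\;\rho_2-r_1+1/2,\;\rho_2-r_2+1/2};1\right],$$ $$I_{2n+1}(x)=\eta_{2n+1}(x-\rho_2)\,{}_4F_3\!\left[{-n,\;n+g+2,\;\rho_2+x+1,\;\rho_2-x+1\atop \rho_1+\rho_2+2,\;\rho_2-r_1+3/2,\;\rho_2-r_2+3/2};1\right],$$ $$\eta_{2n}=\frac{(\rho_1+\rho_2+1)_n(\rho_2-r_1+1/2)_n(\rho_2-r_2+1/2)_n}{(n+g+1)_n},\quad \eta_{2n+1}=\frac{(\rho_1+\rho_2+2)_n(\rho_2-r_1+3/2)_n(\rho_2-r_2+3/2)_n}{(n+g+2)_n}.$$ The Chihara polynomials are the monic polynomials $$C_{2n}(x)=(-1)^n\frac{(\alpha+1)_n}{(n+\alpha+\beta+1)_n}\,{}_2F_1\!\left[{-n,\;n+\alpha+\beta+1\atop \alpha+1};x^2-\gamma^2\right],$$ $$C_{2n+1}(x)=(-1)^n\frac{(\alpha+2)_n}{(n+\alpha+\beta+2)_n}(x-\gamma)\,{}_2F_1\!\left[{-n,\;n+\alpha+\beta+2\atop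 \alpha+2};x^2-\gamma^2\right].$$ The parameters are assumed to be such that these expressions are defined: $b_1+b_2=\alpha+\beta\notin\{-2,-3,\ldots\}$, with products of Pochhammer prefactors and hypergeometric series understood as polynomials (expanded termwise, common factors cancelled). *)

(* Defs.v *)
From HB Require Import structures.
From mathcomp Require Import all_boot all_order all_algebra.
From mathcomp Require Import all_classical all_reals all_analysis.
From mathcomp Require Import ring.
Set Implicit Arguments.
Unset Strict Implicit.
Unset Printing Implicit Defensive.
Import Order.TTheory GRing.Theory Num.Theory.
Import numFieldNormedType.Exports.
Local Open Scope ring_scope.

(* (a)_n, the rising factorial. *)
Definition poch (R : realType) (a : R) (n : nat) : R :=
  \prod_(i < n) (a + i%:R).

(* The series pFq(us; bs; z) truncated after degree n; this is the whole series
   when - n%:R is among the upper parameters us.  As division by zero is total,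
   the value is meaningful only if no (b)_n with b in bs vanishes. *)
Definition hyp (R : realType) (n : nat) (us bs : seq R) (z : R) : R :=
  \sum_(k < n.+1) (\prod_(a <- us) poch a k)
    / ((\prod_(b <- bs) poch b k) * (k`!)%:R) * z ^+ k.

(* The product (\prod_(b <- bs) (b)_n) * pFq(us; bs; z), expanded termwise with
   the common factors cancelled: (b)_n / (b)_k becomes (b + k)_(n - k).  It is
   defined for all lower parameters; see pochhypE for the generic case. *)
Definition pochhyp (R : realType) (n : nat) (us bs : seq R) (z : R) : R :=
  \sum_(k < n.+1) (\prod_(a <- us) poch a k)
    * (\prod_(b <- bs) poch (b + k%:R) (n - k)) / (k`!)%:R * z ^+ k.

Lemma poch_split (R : realType) (a : R) (n k : nat) : (k <= n)%N ->
  poch a n = poch a k * poch (a + k%:R) (n - k).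
Proof.
have poch_add m : poch a (k + m) = poch a k * poch (a + k%:R) m.
  rewrite /poch big_split_ord /=; congr (_ * _).
  by apply: eq_bigr => i _; rewrite natrD addrA.
by move=> kn; rewrite -poch_add subnKC.
Qed.

Lemma pochhypE (R : realType) (n : nat) (us bs : seq R) (z : R) :
  (forall b, b \in bs -> poch b n != 0) ->
  pochhyp n us bs z = (\prod_(b <- bs) poch b n) * hyp n us bs z.
Proof.
move=> bs0; rewrite /hyp mulr_sumr; apply: eq_bigr => -[k /= kn] _.
have pk0 : \prod_(b <- bs) poch b k != 0.
  rewrite prodf_seq_neq0; apply/allP => b /bs0.
  by rewrite (@poch_split _ b n k) // mulf_eq0 => /norP[].
have -> : \prod_(b <- bs) poch b n =
    (\prod_(b <- bs) poch b k) * \prod_(b <- bs) poch (b + k%:R) (n - k).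
  by rewrite -big_split /=; apply: eq_bigr => b _; exact: poch_split.
have k0 : (k`!)%:R != 0 :> R by rewrite pnatr_eq0 -lt0n fact_gt0.
by field; rewrite ?pk0 ?k0.
Qed.

(* Monic complementary Bannai-Ito polynomials (as functions of x): cbi_even n is
   I_{2n} and cbi_odd n is I_{2n+1}.  The numerator of the normalization eta is
   absorbed in pochhyp; its denominator is kept as a genuine division. *)
Definition cbi_even (R : realType) (rho1 rho2 r1 r2 : R) (n : nat) (x : R) : R :=
  let g := rho1 + rho2 - r1 - r2 in
  (poch (n%:R + g + 1) n)^-1 *
  pochhyp n
    [:: - n%:R; n%:R + g + 1; rho2 + x; rho2 - x]
    [:: rho1 + rho2 + 1; rho2 - r1 + 1 / 2; rho2 - r2 + 1 / 2] 1.

Definition cbi_odd (R : realType) (rho1 rho2 r1 r2 : R) (n : nat) (x : R) : R :=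
  let g := rho1 + rho2 - r1 - r2 in
  (poch (n%:R + g + 2) n)^-1 * (x - rho2) *
  pochhyp n
    [:: - n%:R; n%:R + g + 2; rho2 + x + 1; rho2 - x + 1]
    [:: rho1 + rho2 + 2; rho2 - r1 + 3 / 2; rho2 - r2 + 3 / 2] 1.

Definition cbi (R : realType) (rho1 rho2 r1 r2 : R) (n : nat) (x : R) : R :=
  if odd n then cbi_odd rho1 rho2 r1 r2 n./2 x
  else cbi_even rho1 rho2 r1 r2 n./2 x.

(* Same conventions: chihara_even n is C_{2n} and chihara_odd n is C_{2n+1}. *)
Definition chihara_even (R : realType) (alpha beta gamma : R) (n : nat) (x : R)
    : R :=
  (-1) ^+ n / poch (n%:R + alpha + beta + 1) n *
  pochhyp n [:: - n%:R; n%:R + alpha + beta + 1] [:: alpha + 1]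
    (x ^+ 2 - gamma ^+ 2).

Definition chihara_odd (R : realType) (alpha beta gamma : R) (n : nat) (x : R)
    : R :=
  (-1) ^+ n / poch (n%:R + alpha + beta + 2) n * (x - gamma) *
  pochhyp n [:: - n%:R; n%:R + alpha + beta + 2] [:: alpha + 2]
    (x ^+ 2 - gamma ^+ 2).

Definition chihara (R : realType) (alpha beta gamma : R) (n : nat) (x : R) : R :=
  if odd n then chihara_odd alpha beta gamma n./2 x
  else chihara_even alpha beta gamma n./2 x.

(* F_n^(h)(x) = h^n I_n(x/h) with rho_i = a_i/h + b_i and r_i = a_i/h. *)
Definition scaled_cbi (R : realType) (a1 a2 b1 b2 h : R) (n : nat) (x : R) : R :=
  h ^+ n * cbi (a1 / h + b1) (a2 / h + b2) (a1 / h) (a2 / h) n (x / h).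

(* Main.v *)
(* As h -> 0+, a Pochhammer factor with parameter c/h + d satisfies
   h^m (c/h + d)_m -> c^m.  In the k-th term of the 4F3 series, h^(2n) splits as
   h^k h^k h^(n-k) h^(n-k), one power for each Pochhammer factor whose parameter
   grows like 1/h; so the series tends termwise to a 2F1.  The quantity g and
   the parameter rho2 - r2 do not depend on h.  The Chihara limit is the same
   limit after rescaling x by sqrt (a1^2 - a2^2). *)
Require Import Defs.
From HB Require Import structures.
From mathcomp Require Import all_boot all_order all_algebra.
From mathcomp Require Import all_classical all_reals all_analysis.
From mathcomp Require Import ring.
Set Implicit Arguments.
Unset Strict Implicit.
Unset Printing Implicit Defensive.
Import Order.TTheory GRing.Theory Num.Theory.
Import numFieldNormedType.Exports.
Local Open Scope classical_set_scope.
Local Open Scope ring_scope.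

Lemma pochS (R : realType) (a : R) (m : nat) :
  poch a m.+1 = poch a m * (a + m%:R).
Proof. by rewrite /poch big_ord_recr. Qed.

(** Each of the [m] factors absorbs one power of [h]: [h * (c / h + d + i) = c + h * (d + i)], which
    tends to [c]. *)
Lemma cvg_scaled_poch (R : realType) (c d : R) (m : nat) :
  h ^+ m * poch (c / h + d) m @[h --> 0^'+] --> c ^+ m.
Proof.
elim: m => [|m IH].
  by under eq_fun do rewrite /poch big_ord0 expr0 mulr1; exact: cvg_cst.
under eq_fun do rewrite pochS exprSr mulrACA.
rewrite exprSr; apply: cvgM => //.
have h0 : h @[h --> (0 : R)^'+] --> (0 : R) by apply: cvg_at_right_filter.
(* The cancellation [h * (c / h) = c] fails at [h = 0], so the two functions are only compared
   eventually along [0^'+]. *)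
have /(cvg_trans _) : c + h * (d + m%:R) @[h --> 0^'+] --> c.
  rewrite -[X in _ --> X]addr0 -[in X in _ --> X](mul0r (d + m%:R)).
  by apply: cvgD; [exact: cvg_cst|apply: cvgM => //; exact: cvg_cst].
apply; apply: near_eq_cvg; near=> h.
have h_neq0 : h != 0 by rewrite gt_eqF//; near: h; exact: nbhs_right_gt.
by field.
Unshelve. all: by end_near. Qed.

(** The [k]-th term tends to a multiple of [(p1 * p2) ^+ k * (s1 * s2) ^+ (n - k)]. Factoring out
    [(s1 * s2) ^+ n] leaves the argument [p1 * p2 / (s1 * s2)], hence the condition on [s1 * s2]. *)
Lemma cvg_scaled_pochhyp (R : realType) (n : nat)
    (u v w p1 q1 p2 q2 s1 t1 s2 t2 : R) :
  s1 * s2 != 0 ->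
  h ^+ n.*2 * pochhyp n [:: u; v; p1 / h + q1; p2 / h + q2]
                        [:: s1 / h + t1; s2 / h + t2; w] 1 @[h --> 0^'+] -->
  (s1 * s2) ^+ n * pochhyp n [:: u; v] [:: w] (p1 * p2 / (s1 * s2)).
Proof.
move=> s_neq0; rewrite /pochhyp mulr_sumr.
under eq_fun do rewrite mulr_sumr.
apply: cvg_big => [|[k k_lt] _]; first exact: add_continuous.
have kn : (k <= n)%N := k_lt.
rewrite /= !big_cons !big_nil.
(* [A] gathers the factors of the term that do not depend on [h]. *)
set A := poch u k * poch v k * poch (w + k%:R) (n - k) / k`!%:R.
have -> : (s1 * s2) ^+ n * (poch u k * (poch v k * 1) *
    (poch (w + k%:R) (n - k) * 1) / k`!%:R * (p1 * p2 / (s1 * s2)) ^+ k) =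
    A * (p1 ^+ k * p2 ^+ k * (s1 ^+ (n - k) * s2 ^+ (n - k))).
  rewrite -!exprMn -{1}(subnKC kn) exprD (expr_div_n (p1 * p2)) /A.
  have sk0 : (s1 * s2) ^+ k != 0 by rewrite expf_neq0.
  have k0 : k`!%:R != 0 :> R by rewrite pnatr_eq0 -lt0n fact_gt0.
  by move: ((s1 * s2) ^+ k) sk0 => S S0; field; rewrite k0 S0.
have E h : h ^+ n.*2 = h ^+ k * h ^+ k * (h ^+ (n - k) * h ^+ (n - k)) :> R.
  by rewrite -!exprD !addnn -doubleD subnKC.
(* The shift by [k] in the growing lower parameters joins the bounded parts [t1] and [t2], so
   [cvg_scaled_poch] applies with length [n - k]. *)
rewrite [X in X @ _ --> _](_ : _ = fun h => A *
    ((h ^+ k * poch (p1 / h + q1) k) * (h ^+ k * poch (p2 / h + q2) k) *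
     ((h ^+ (n - k) * poch (s1 / h + (t1 + k%:R)) (n - k)) *
      (h ^+ (n - k) * poch (s2 / h + (t2 + k%:R)) (n - k))))); last first.
  apply/funext => h.
  by rewrite !big_cons !big_nil expr1n E /A !(addrA (_ / h)); ring.
by apply: cvgM; [exact: cvg_cst|do 2?apply: cvgM; exact: cvg_scaled_poch].
Qed.

Lemma cvg_scaled_cbi_even (R : realType) (a1 a2 b1 b2 : R) (n : nat) (x : R) :
  a2 ^+ 2 < a1 ^+ 2 ->
  scaled_cbi a1 a2 b1 b2 h n.*2 x @[h --> 0^'+] -->
    (a2 ^+ 2 - a1 ^+ 2) ^+ n / poch (n%:R + b1 + b2 + 1) n *
    pochhyp n [:: - n%:R; n%:R + b1 + b2 + 1] [:: b2 + 1 / 2]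
      ((a2 ^+ 2 - x ^+ 2) / (a2 ^+ 2 - a1 ^+ 2)).
Proof.
move=> ha; rewrite !subr_sqr mulrAC mulrC.
rewrite [(a2 - x) * _]mulrC [(a2 - a1) * _]mulrC.
under eq_fun => h.
  rewrite /scaled_cbi /cbi odd_double doubleK /cbi_even /=.
  (* Every parameter is put in the form [c / h + d]. These identities are linear in the inverse of
     [h], so they hold for all [h]. *)
  rewrite (_ : a1 / h + b1 + (a2 / h + b2) - a1 / h - a2 / h = b1 + b2);
    last by ring.
  rewrite (_ : a2 / h + b2 + x / h = (a2 + x) / h + b2); last by ring.
  rewrite (_ : a2 / h + b2 - x / h = (a2 - x) / h + b2); last by ring.
  rewrite (_ : a1 / h + b1 + (a2 / h + b2) + 1 = (a2 + a1) / h + (b1 + b2 + 1));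
    last by ring.
  rewrite (_ : a2 / h + b2 - a1 / h + 1 / 2 = (a2 - a1) / h + (b2 + 1 / 2));
    last by ring.
  rewrite (_ : a2 / h + b2 - a2 / h + 1 / 2 = b2 + 1 / 2); last by ring.
  rewrite addrA mulrCA.
  over.
apply: cvgM; first exact: cvg_cst.
by apply: cvg_scaled_pochhyp; rewrite mulrC -subr_sqr subr_eq0 lt_eqF.
Qed.

(** The odd power of [h] left over by the series is absorbed by the linear prefactor
    [x / h - rho2 = (x - a2) / h - b2]. *)
Lemma cvg_scaled_cbi_odd (R : realType) (a1 a2 b1 b2 : R) (n : nat) (x : R) :
  a2 ^+ 2 < a1 ^+ 2 ->
  scaled_cbi a1 a2 b1 b2 h n.*2.+1 x @[h --> 0^'+] -->
    (a2 ^+ 2 - a1 ^+ 2) ^+ n / poch (n%:R + b1 + b2 + 2) n * (x - a2) *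
    pochhyp n [:: - n%:R; n%:R + b1 + b2 + 2] [:: b2 + 3 / 2]
      ((a2 ^+ 2 - x ^+ 2) / (a2 ^+ 2 - a1 ^+ 2)).
Proof.
move=> ha; rewrite !subr_sqr.
rewrite [(a2 - x) * _]mulrC [(a2 - a1) * _]mulrC.
set P := pochhyp _ _ _ _; set c := poch _ _.
rewrite (_ : _ * P = c^-1 * (x - a2) * (((a2 + a1) * (a2 - a1)) ^+ n * P));
    last by ring.
rewrite [X in X @ _ --> _](_ : _ = fun h => c^-1 *
    (h * ((x - a2) / h + - b2)) * (h ^+ n.*2 * pochhyp n
      [:: - n%:R; n%:R + b1 + b2 + 2; (a2 + x) / h + (b2 + 1);
          (a2 - x) / h + (b2 + 1)]
      [:: (a2 + a1) / h + (b1 + b2 + 2); (a2 - a1) / h + (b2 + 3 / 2);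
          b2 + 3 / 2] 1)); last first.
  apply/funext => h.
  rewrite /scaled_cbi /cbi /= odd_double /= uphalf_double /cbi_odd.
  rewrite (_ : a1 / h + b1 + (a2 / h + b2) - a1 / h - a2 / h = b1 + b2);
    last by ring.
  rewrite (_ : a2 / h + b2 + x / h + 1 = (a2 + x) / h + (b2 + 1)); last by ring.
  rewrite (_ : a2 / h + b2 - x / h + 1 = (a2 - x) / h + (b2 + 1)); last by ring.
  rewrite (_ : a1 / h + b1 + (a2 / h + b2) + 2 = (a2 + a1) / h + (b1 + b2 + 2));
    last by ring.
  rewrite (_ : a2 / h + b2 - a1 / h + 3 / 2 = (a2 - a1) / h + (b2 + 3 / 2));
    last by ring.
  rewrite (_ : a2 / h + b2 - a2 / h + 3 / 2 = b2 + 3 / 2); last by ring.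
  rewrite [n%:R + (b1 + b2)]addrA exprSr -/c.
  by move: (pochhyp _ _ _ _) => Q; ring.
apply: cvgM; last first.
  by apply: cvg_scaled_pochhyp; rewrite mulrC -subr_sqr subr_eq0 lt_eqF.
apply: cvgM; first exact: cvg_cst.
(* The linear prefactor is a Pochhammer symbol of length one. *)
have := @cvg_scaled_poch R (x - a2) (- b2) 1.
by under eq_fun do rewrite /poch big_ord1 addr0 expr1.
Qed.

Theorem mainTheorem3 (R : realType) (a1 a2 b1 b2 : R)
  (ha : a1 ^+ 2 > a2 ^+ 2)
  (hb : forall k : nat, b1 + b2 != - (k.+2)%:R) :
  (forall (n : nat) (x : R),
     scaled_cbi a1 a2 b1 b2 h n.*2 x @[h --> 0^'+] -->
       (a2 ^+ 2 - a1 ^+ 2) ^+ n / poch (n%:R + b1 + b2 + 1) n *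
       pochhyp n [:: - n%:R; n%:R + b1 + b2 + 1] [:: b2 + 1 / 2]
         ((a2 ^+ 2 - x ^+ 2) / (a2 ^+ 2 - a1 ^+ 2))) /\
  (forall (n : nat) (x : R),
     scaled_cbi a1 a2 b1 b2 h n.*2.+1 x @[h --> 0^'+] -->
       (a2 ^+ 2 - a1 ^+ 2) ^+ n / poch (n%:R + b1 + b2 + 2) n * (x - a2) *
       pochhyp n [:: - n%:R; n%:R + b1 + b2 + 2] [:: b2 + 3 / 2]
         ((a2 ^+ 2 - x ^+ 2) / (a2 ^+ 2 - a1 ^+ 2))) /\
  (let alpha := b2 - 1 / 2 in
   let beta := b1 + 1 / 2 in
   let gamma := a2 / Num.sqrt (a1 ^+ 2 - a2 ^+ 2) in
   forall (n : nat) (x : R),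
     (a1 ^+ 2 - a2 ^+ 2) `^ (- (n%:R / 2)) *
       scaled_cbi a1 a2 b1 b2 h n (x * Num.sqrt (a1 ^+ 2 - a2 ^+ 2))
       @[h --> 0^'+] -->
     chihara alpha beta gamma n x).
Proof.
split; first by move=> n x; exact: cvg_scaled_cbi_even.
split; first by move=> n x; exact: cvg_scaled_cbi_odd.
move=> alpha beta gamma n x.
set D := a1 ^+ 2 - a2 ^+ 2; set s := Num.sqrt D.
have D_gt0 : 0 < D by rewrite subr_gt0.
have s_neq0 : s != 0 by rewrite gt_eqF// sqrtr_gt0.
have sD : s ^+ 2 = D by rewrite sqr_sqrtr// ltW.
have powD : D `^ (- (n%:R / 2)) = (s ^+ n)^-1.
  by rewrite powRN [_ / 2]mulrC powRrM powR12_sqrt ?ltW// powR_mulrn ?sqrtr_ge0.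
(* Here [a2 = gamma * s] and [a2 ^+ 2 - a1 ^+ 2 = - s ^+ 2], so [s] cancels. *)
have argE : (a2 ^+ 2 - (x * s) ^+ 2) / (a2 ^+ 2 - a1 ^+ 2) =
    x ^+ 2 - gamma ^+ 2.
  rewrite -(opprB (a1 ^+ 2)) -/D -sD /gamma -/D -/s.
  by field.
have sumE : alpha + beta = b1 + b2 by rewrite /alpha /beta; field.
(* This yields the sign in the Chihara normalization and the power of [s] that cancels the rescaling
   prefactor. *)
have DE m : (a2 ^+ 2 - a1 ^+ 2) ^+ m = (-1) ^+ m * s ^+ m.*2.
  by rewrite -(opprB (a1 ^+ 2)) -/D -sD -[- s ^+ 2]mulN1r exprMn -exprM mul2n.
rewrite powD -(odd_double_half n); case: (odd n) => /=;
  rewrite ?add0n ?add1n; set m := n./2.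
(* In odd degree the one remaining [s] is cancelled by [x - gamma = (x * s - a2) / s]. *)
- have -> : chihara alpha beta gamma m.*2.+1 x = (s ^+ m.*2.+1)^-1 *
      ((a2 ^+ 2 - a1 ^+ 2) ^+ m / poch (m%:R + b1 + b2 + 2) m * (x * s - a2) *
       pochhyp m [:: - m%:R; m%:R + b1 + b2 + 2] [:: b2 + 3 / 2]
         ((a2 ^+ 2 - (x * s) ^+ 2) / (a2 ^+ 2 - a1 ^+ 2))).
    rewrite argE DE /chihara /= odd_double /= uphalf_double /chihara_odd.
    rewrite -!(addrA m%:R) sumE (_ : alpha + 2 = b2 + 3 / 2); last first.
      by rewrite /alpha; field.
    set P := pochhyp _ _ _ _; set c := (poch _ _)^-1.
    rewrite (_ : x - gamma = (x * s - a2) / s); last first.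
      by rewrite /gamma -/D -/s; field.
    have := expf_neq0 m.*2 s_neq0; rewrite exprSr.
    by clearbody c P; move: (s ^+ m.*2) => S S_neq0; field; rewrite s_neq0 S_neq0.
  by apply: cvgM; [exact: cvg_cst|exact: cvg_scaled_cbi_odd].
- have -> : chihara alpha beta gamma m.*2 x = (s ^+ m.*2)^-1 *
      ((a2 ^+ 2 - a1 ^+ 2) ^+ m / poch (m%:R + b1 + b2 + 1) m *
       pochhyp m [:: - m%:R; m%:R + b1 + b2 + 1] [:: b2 + 1 / 2]
         ((a2 ^+ 2 - (x * s) ^+ 2) / (a2 ^+ 2 - a1 ^+ 2))).
    rewrite argE DE /chihara odd_double doubleK /chihara_even.
    rewrite -!(addrA m%:R) sumE (_ : alpha + 1 = b2 + 1 / 2); last first.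
      by rewrite /alpha; field.
    set P := pochhyp _ _ _ _; set c := (poch _ _)^-1.
    have := expf_neq0 m.*2 s_neq0.
    by clearbody c P; move: (s ^+ m.*2) => S S_neq0; field.
  by apply: cvgM; [exact: cvg_cst|exact: cvg_scaled_cbi_even].
Qed.
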